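(* Let $X$ be a locally compact Hausdorff space and $\overline{X}$ a metrizable compactification of $X$. Let $(X,\mathcal{B},\mathbf{b})$ be the coarse proximity structure on $X$ induced by the compactification $\overline{X}$. Then $$asInd(X)=Ind(\mathcal{U}X)=Ind(\overline{X}\setminus X).$$
   Context: Coarse proximity spaces. A bornology on a set $X$ is a family $\mathcal{B}$ of subsets of $X$ that contains all singletons, is closed under taking subsets, and is closed under unions of two members. Members of $\mathcal{B}$ are called bounded; other subsets of $X$ are unbounded. A coarse proximity space is a triple $(X,\mathcal{B},\mathbf{b})$ where $\mathcal{B}$ is a bornology on $X$ and $\mathbf{b}$ is a relation on the power set of $X$ such that for all $A,B,C\subseteq X$ (writing $\bar{\mathbf{b}}$ for the negation of $\mathbf{b}$): (1) $A\mathbf{b}B\Rightarrow B\mathbf{b}A$; (2) $A\mathbf{b}B\Rightarrow A,B\notin\mathcal{B}$; (3) $A\cap B\notin\mathcal{B}\Rightarrow A\mathbf{b}B$; (4) $(A\cup B)\mathbf{b}C\iff A\mathbf{b}C$ or $B\mathbf{b}C$; (5) $A\bar{\mathbf{b}}B\Rightarrow$ there is $E\subseteq X$ with $A\bar{\mathbf{b}}E$ and $(X\setminus E)\bar{\mathbf{b}}B$. A subset $Y\subseteq X$ carries the subspace coarse proximity structure: bornology $\{B\cap Y: B\in\mathcal{B}\}$, and $A\mathbf{b}_YC\iff A\mathbf{b}C$ for $A,C\subseteq Y$. The coarse proximity structure induced by a compactification $\overline{X}$ of a locally compact Hausdorff space $X$: $\mathcal{B}$ is the set of all $K\subseteq X$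 with $cl_X(K)$ compact, and $A\mathbf{b}B\iff cl_{\overline{X}}(A)\cap cl_{\overline{X}}(B)\cap(\overline{X}\setminus X)\neq\emptyset$. Boundary. The discrete extension of $\mathbf{b}$ is the separated proximity $\delta$ on $X$ given by $A\delta B\iff(A\cap B\neq\emptyset$ or $A\mathbf{b}B)$. A cluster of $(X,\delta)$ is a collection $\sigma$ of nonempty subsets of $X$ such that $A\delta B$ for all $A,B\in\sigma$; if $C\delta A$ for all $A\in\sigma$ then $C\in\sigma$; and if $A\cup B\in\sigma$ then $A\in\sigma$ or $B\in\sigma$. The Smirnov compactification $\mathfrak{X}$ is the set of all clusters with the separated proximity $\delta^*$: $\mathcal{A}\delta^*\mathcal{C}$ iff $A\delta C$ for all $A,C\subseteq X$ such that $A\in\sigma$ for every $\sigma\in\mathcal{A}$ and $C\in\sigma$ for every $\sigma\in\mathcal{C}$. Its topology (closure of $\mathcal{A}$ is $\{\sigma:\{\sigma\}\delta^*\mathcal{A}\}$) is compact Hausdorff, and $X$ is identified with the dense set of point clusters (those containing a singleton); then $cl_{\mathfrak{X}}(A)=\{\sigma\in\mathfrak{X}:A\in\sigma\}$ for $A\subseteq X$. The boundary $\mathcal{U}X\subseteq\mathfrak{X}$ is the subspace of clusters containing no bounded set (it is compact Hausdorff). The trace of $A\subseteq X$ is $A'=cl_{\mathfrak{X}}(A)\cap\mathcal{U}X$. Dimensions. A separator between disjoint subsets $A,B$ of a topological space $T$ is a set $C\subseteq T$ such that $T\setminus C=U\cup V$ with $U,V$ disjoint open in $T$, $A\subseteq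 U$, $B\subseteq V$. The large inductive dimension of a normal space $T$: $Ind(T)=-1$ iff $T=\emptyset$; for $n\ge 0$, $Ind(T)\le n$ if for every pair of disjoint closed $A,B\subseteq T$ there is a separator $C$ between them with $Ind(C)\le n-1$; $Ind(T)=n$ if $n\ge -1$ is the smallest integer with $Ind(T)\le n$; $Ind(T)=\infty$ if there is no such integer. If $A\bar{\mathbf{b}}B$ in $X$, an asymptotic separator between $A$ and $B$ is a set $C\subseteq X$ such that $C'$ is a separator in $\mathcal{U}X$ between $A'$ and $B'$. The asymptotic inductive dimension: $asInd(X)=-1$ iff $X$ is bounded; for $n\ge0$, $asInd(X)\le n$ if for all $A,B\subseteq X$ with $A\bar{\mathbf{b}}B$ there is an asymptotic separator $C\subseteq X$ between $A$ and $B$ with $asInd(C)\le n-1$ ($C$ with the subspace coarse proximity structure); $asInd(X)=n$ if $n\ge-1$ is the smallest integer with $asInd(X)\le n$; $asInd(X)=\infty$ if there is no such integer. *)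

(* Defs.v *)
From HB Require Import structures.
From mathcomp Require Import all_boot all_order all_algebra.
From mathcomp Require Import all_classical all_reals all_analysis.

Set Implicit Arguments.
Unset Strict Implicit.
Unset Printing Implicit Defensive.

Import Order.TTheory GRing.Theory Num.Theory.
Local Open Scope classical_set_scope.

Lemma closure_subset_closed (T : topologicalType) (A C : set T) :
  closed C -> A `<=` C -> closure A `<=` C.
Proof. by move=> /closure_id cC AC; rewrite cC; exact: closureS. Qed.

Record bornology (X : Type) (B : set (set X)) : Prop := Bornology {
  bornology1 : forall x, B [set x] ;
  bornologyS : forall A C, A `<=` C -> B C -> B A ;
  bornologyU : forall A C, B A -> B C -> B (A `|` C) }.

Record coarse_proximity (X : Type) := CoarseProximity {
  cbounded : set (set X) ;
  cnear : set X -> set X -> Prop ;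
  cbounded_bornology : bornology cbounded ;
  cnear_sym : forall A B, cnear A B -> cnear B A ;
  cnear_unbounded : forall A B, cnear A B -> ~ cbounded A /\ ~ cbounded B ;
  cnearI : forall A B, ~ cbounded (A `&` B) -> cnear A B ;
  cnearU : forall A B C, cnear (A `|` B) C <-> cnear A C \/ cnear B C ;
  cnear_strong : forall A B, ~ cnear A B ->
    exists E, ~ cnear A E /\ ~ cnear (~` E) B }.

Section coarse_proximity_theory.
Context {X : Type} (b : coarse_proximity X).
Implicit Types A B C D E : set X.

Lemma cnear_subl A B C : A `<=` B -> cnear b A C -> cnear b B C.
Proof. by move=> /setUidr <- AC; apply/cnearU; left. Qed.

Lemma cnear_subr A B C : A `<=` B -> cnear b C A -> cnear b C B.
Proof. by move=> AB /cnear_sym CA; apply/cnear_sym/(cnear_subl AB). Qed.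

End coarse_proximity_theory.

Section subspace.
Context {X : Type} (b : coarse_proximity X) (Y : set X).

Definition sub_bounded : set (set Y) :=
  [set K | exists2 B, cbounded b B & K = set_val @^-1` B].

Definition sub_near (A C : set Y) := cnear b (set_val @` A) (set_val @` C).

Let set_val_inj (y z : Y) : set_val y = set_val z -> y = z.
Proof. by rewrite set_valE; exact: val_inj. Qed.

Let preimage_val (A : set Y) : set_val @^-1` (set_val @` A) = A.
Proof.
apply/seteqP; split => [y [z Az /set_val_inj <-] //|y Ay]; by exists y.
Qed.

Let sub_boundedE (K : set Y) : sub_bounded K <-> cbounded b (set_val @` K).
Proof.
split => [[B bB ->]|bK]; last by exists (set_val @` K); rewrite ?preimage_val.
by apply: (bornologyS (cbounded_bornology b)) bB => _ [y By <-].
Qed.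

Let sub_bornology : bornology sub_bounded.
Proof.
have [b1 bS bU] := cbounded_bornology b; split.
- by move=> y; apply/sub_boundedE; rewrite image_set1; exact: b1.
- move=> A C AC /sub_boundedE bC; apply/sub_boundedE; apply: bS bC.
  exact: image_subset.
- move=> A C /sub_boundedE bA /sub_boundedE bC; apply/sub_boundedE.
  by rewrite image_setU; exact: bU.
Qed.

Let sub_near_sym A B : sub_near A B -> sub_near B A.
Proof. exact: cnear_sym. Qed.

Let sub_near_unbounded A B :
  sub_near A B -> ~ sub_bounded A /\ ~ sub_bounded B.
Proof. by move/cnear_unbounded => [uA uB]; split => /sub_boundedE. Qed.

Let sub_nearI A B : ~ sub_bounded (A `&` B) -> sub_near A B.
Proof.
move=> uAB; apply: cnearI => bAB; apply: uAB; apply/sub_boundedE.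
apply: (bornologyS (cbounded_bornology b)) bAB => _ [y [Ay By] <-].
by split; exists y.
Qed.

Let sub_nearU A B C : sub_near (A `|` B) C <-> sub_near A C \/ sub_near B C.
Proof. by rewrite /sub_near image_setU; exact: cnearU. Qed.

Let sub_near_strong A B : ~ sub_near A B ->
  exists E, ~ sub_near A E /\ ~ sub_near (~` E) B.
Proof.
move=> /cnear_strong[E [nAE nEB]]; exists (set_val @^-1` E); split.
  by move=> AE; apply: nAE; apply: cnear_subr AE => _ [y Ey <-].
by move=> EB; apply: nEB; apply: cnear_subl EB => _ [y Ey <-].
Qed.

Definition sub_coarse_proximity : coarse_proximity Y :=
  CoarseProximity sub_bornology sub_near_sym sub_near_unbounded sub_nearI
    sub_nearU sub_near_strong.

End subspace.

Section discrete_extension.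
Context {X : Type} (b : coarse_proximity X).
Implicit Types A B C D E : set X.

Definition dnear A B := A `&` B !=set0 \/ cnear b A B.

Lemma dnear_sym A B : dnear A B -> dnear B A.
Proof. by case=> [|/cnear_sym]; [rewrite setIC; left|right]. Qed.

Lemma dnearU A B C : dnear (A `|` B) C <-> dnear A C \/ dnear B C.
Proof.
rewrite /dnear setIUl cnearU; split.
  case=> [[x [ACx|BCx]]|[AC|BC]].
  - by left; left; exists x.
  - by right; left; exists x.
  - by left; right.
  - by right; right.
case=> [[[x ACx]|AC]|[[x BCx]|BC]].
- by left; exists x; left.
- by right; left.
- by left; exists x; right.
- by right; right.
Qed.

Lemma dnear_subl A B C : A `<=` B -> dnear A C -> dnear B C.
Proof. by move=> /setUidr <- AC; apply/dnearU; left. Qed.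

Lemma dnear_strong A B : ~ dnear A B ->
  exists E, ~ dnear A E /\ ~ dnear (~` E) B.
Proof.
move=> /not_orP[dAB nAB]; have [E [nAE nEB]] := cnear_strong nAB.
exists ((E `|` B) `\` A); split.
  case=> [[x [Ax []]] //|]; move=> /(@cnear_subr _ b _ (E `|` B) _).
  by case/(_ (@subDsetl _ _ _))/cnear_sym/cnearU => /cnear_sym.
case=> [[x [nx Bx]]|].
  by apply: nx; split; [right|move=> Ax; apply: dAB; exists x].
move=> /(@cnear_subl _ b _ (~` E `|` A)); case/(_ _)/cnearU => //.
by move=> x /= nx; apply: contrapT => /not_orP[/contrapT Ex nAx]; apply: nx;
  split => //; left.
Qed.

(* Nonempty members, yet no nonemptiness of the collection is asked: by
   [cluster_max] an empty collection would have to contain set0. *)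
Record is_cluster (s : set (set X)) : Prop := IsCluster {
  cluster_neq0 : forall A, s A -> A !=set0 ;
  cluster_near : forall A B, s A -> s B -> dnear A B ;
  cluster_max : forall C, (forall A, s A -> dnear C A) -> s C ;
  cluster_split : forall A B, s (A `|` B) -> s A \/ s B }.

Record smirnov := Smirnov {
  smirnov_set :> set X -> Prop ;
  smirnov_cluster : is_cluster smirnov_set }.

End discrete_extension.

Arguments smirnov {X} b.

HB.instance Definition _ X (b : coarse_proximity X) :=
  gen_eqMixin (smirnov b).
HB.instance Definition _ X (b : coarse_proximity X) :=
  gen_choiceMixin (smirnov b).

Section smirnov_topology.
Context {X : Type} (b : coarse_proximity X).
Implicit Types (A B C D E : set X) (s t : smirnov b) (F G : set (smirnov b)).

Lemma smirnov_sub s A B : A `<=` B -> s A -> s B.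
Proof.
move=> AB sA; apply: (cluster_max (smirnov_cluster s)) => D sD.
exact/(dnear_subl AB)/(cluster_near (smirnov_cluster s)).
Qed.

Lemma smirnov0 s : ~ s set0.
Proof. by move/(cluster_neq0 (smirnov_cluster s)) => -[]. Qed.

Lemma smirnovT s : s setT.
Proof.
apply: contrapT => nsT; apply: (@smirnov0 s).
apply: (cluster_max (smirnov_cluster s)) => A sA.
by case: nsT; exact: smirnov_sub sA.
Qed.

Definition smirnov_near F G :=
  forall A C, (forall s, F s -> s A) -> (forall s, G s -> s C) -> dnear b A C.

(* A point near G is one that contains every set absorbing G. *)
Lemma smirnov_near1P s G : smirnov_near [set s] G <->
  forall C, (forall t, G t -> t C) -> s C.
Proof.
split=> [sG C GC|sG A C sA GC].
  apply: (cluster_max (smirnov_cluster s)) => A sA.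
  by apply: dnear_sym; apply: sG => // _ ->.
by apply: (cluster_near (smirnov_cluster s)); [exact: sA|exact: sG].
Qed.

Definition smirnov_open : set (set (smirnov b)) :=
  [set U | forall s, U s -> ~ smirnov_near [set s] (~` U)].

Let smirnov_openT : smirnov_open setT.
Proof.
by move=> s _ /smirnov_near1P/(_ set0); rewrite setCT => /(_ _)/smirnov0; apply.
Qed.

Let smirnov_openI : setI_closed smirnov_open.
Proof.
move=> U V oU oV s [Us Vs] /smirnov_near1P sUV.
have /smirnov_near1P/existsNP[C /not_implyP[UC nsC]] := oU _ Us.
have /smirnov_near1P/existsNP[D /not_implyP[VD nsD]] := oV _ Vs.
have /(cluster_split (smirnov_cluster s))[] // : s (C `|` D).
apply: sUV => t; rewrite setCI => -[/UC|/VD]; apply: smirnov_sub.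
  by move=> x; left.
by move=> x; right.
Qed.

Let smirnov_open_bigU (I : Type) (f : I -> set (smirnov b)) :
  (forall i, smirnov_open (f i)) -> smirnov_open (\bigcup_i f i).
Proof.
move=> of_ s [i _ fis] /smirnov_near1P sf; apply: (of_ i s fis).
apply/smirnov_near1P => C fC; apply: sf => t nft; apply: fC => fit.
by apply: nft; exists i.
Qed.

HB.instance Definition _ := isOpenTopological.Build (smirnov b)
  smirnov_openT smirnov_openI smirnov_open_bigU.

Let openE (U : set (smirnov b)) :
  open U <-> forall s, U s -> ~ smirnov_near [set s] (~` U).
Proof. by []. Qed.

Lemma smirnov_closureE G : closure G = [set s | smirnov_near [set s] G].
Proof.
set H := [set s | _].
have GH : G `<=` H by move=> s Gs; apply/smirnov_near1P => C; exact.
have cH : closed H.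
  rewrite -openC; apply/openE => s nHs /smirnov_near1P sH; apply: nHs.
  apply/smirnov_near1P => C GC; apply: contrapT => nsC.
  have [D /not_implyP[sD nCD]] : exists D, ~ (s D -> dnear b C D).
    apply/existsNP => CD; apply: nsC.
    exact: (cluster_max (smirnov_cluster s)).
  have [E [nCE nED]] := dnear_strong nCD.
  have : s (~` E).
    apply: sH => t /contrapT/smirnov_near1P/(_ _ GC) tC.
    have : t (E `|` ~` E) by rewrite setUv; exact: smirnovT.
    case/(cluster_split (smirnov_cluster t)) => // tE; case: nCE.
    exact: (cluster_near (smirnov_cluster t)).
  by move=> sE; case: nED; exact: (cluster_near (smirnov_cluster s)).
apply/seteqP; split; first exact: closure_subset_closed.
move=> s /smirnov_near1P sG.
have /openE oC : open (~` closure G).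
  by apply: closed_openC; exact: closed_closure.
apply: contrapT => /oC; apply.
apply/smirnov_near1P => C clC; apply: sG => t Gt; apply: clC.
by rewrite setCK; exact: subset_closure.
Qed.

(* The copy of A inside the Smirnov compactification, made of the point
   clusters at the points of A. *)
Definition smirnov_points A : set (smirnov b) :=
  [set s | exists2 x, A x & s [set x]].

Lemma point_cluster x : is_cluster b [set A | A x].
Proof.
split=> [A Ax|A B Ax Bx|C Cx|A B //]; first by exists x.
  by left; exists x.
have [[y [Cy /= <-]] //|/cnear_unbounded[_ []]] := Cx [set x] erefl.
exact: (bornology1 (cbounded_bornology b)).
Qed.

Lemma closure_smirnov_points A : closure (smirnov_points A) = [set s | s A].
Proof.
rewrite smirnov_closureE; apply/seteqP; split => [s /smirnov_near1P|s sA /=].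
  by apply=> t [x Ax]; apply: smirnov_sub => _ ->.
apply/smirnov_near1P => C AC; apply: smirnov_sub sA => x Ax.
by apply: (AC (Smirnov (point_cluster x))); exists x.
Qed.

Definition boundary : set (smirnov b) :=
  [set s | forall B, cbounded b B -> ~ s B].

Definition trace A : set boundary :=
  set_val @^-1` closure (smirnov_points A).

End smirnov_topology.

Arguments boundary {X} b.
Arguments trace {X} b A.

Definition separator (T : topologicalType) (A B C : set T) :=
  exists U V : set T, [/\ open U, open V, U `&` V = set0,
    ~` C = U `|` V & A `<=` U /\ B `<=` V].

Definition asymptotic_separator X (b : coarse_proximity X) (A B C : set X) :=
  separator (trace b A) (trace b B) (trace b C).

(* Shifted by one: [Ind_lt n T] is Ind(T) <= n - 1, so n = 0 encodes the value
   -1; likewise for [asInd_lt] below. *)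
Fixpoint Ind_lt (n : nat) (T : topologicalType) : Prop :=
  if n is m.+1 then
    forall A B : set T, closed A -> closed B -> A `&` B = set0 ->
      exists2 C : set T, separator A B C & Ind_lt m (set_type C)
  else [set: T] = set0.

Fixpoint asInd_lt (n : nat) (X : Type) (b : coarse_proximity X) : Prop :=
  if n is m.+1 then
    forall A B : set X, ~ cnear b A B ->
      exists2 C : set X, asymptotic_separator b A B C &
        asInd_lt m (sub_coarse_proximity b C)
  else cbounded b setT.

Definition dim_of (P : nat -> Prop) : \bar int :=
  if pselect (exists n, `[< P n >]) is left exP
  then ((ex_minn exP)%:Z - 1)%R%:E else +oo%E.

Definition Ind (T : topologicalType) : \bar int :=
  dim_of (fun n => Ind_lt n T).

Definition asInd X (b : coarse_proximity X) : \bar int :=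
  dim_of (fun n => asInd_lt n b).

(* Nonnegativity of d follows from the three metric axioms. *)
Definition metrizable (R : realType) (T : topologicalType) :=
  exists d : T -> T -> R,
    [/\ forall x y, d x y = 0%R <-> x = y,
        forall x y, d x y = d y x,
        forall x y z, (d x z <= d x y + d y z)%R &
        forall x (A : set T), nbhs x A <->
          exists2 e : R, (0 < e)%R & [set y | (d x y < e)%R] `<=` A].

Record compactification (X Y : topologicalType) (i : X -> Y) : Prop :=
  Compactification {
    compactification_hausdorff : hausdorff_space Y ;
    compactification_compact : compact [set: Y] ;
    compactification_inj : injective i ;
    compactification_open : forall U : set X,
      open U <-> exists2 V : set Y, open V & U = i @^-1` V ;
    compactification_dense : dense (range i) }.

Definition corona (X Y : topologicalType) (i : X -> Y) : set Y := ~` range i.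

Section induced.
Context {X Y : topologicalType} (i : X -> Y).
Hypotheses (lcX : locally_compact [set: X]) (ci : compactification i).
Implicit Types A B C E : set X.

Definition induced_bounded : set (set X) := [set K | compact (closure K)].

Definition induced_near A B :=
  closure (i @` A) `&` closure (i @` B) `&` corona i !=set0.

Let i_cont : continuous i.
Proof.
by apply/continuousP => V oV; apply/(compactification_open ci); exists V.
Qed.

Let image_closed A : compact A -> closed (i @` A).
Proof.
move=> cA; apply: compact_closed; first exact: compactification_hausdorff ci.
by apply: continuous_compact => //; exact: continuous_subspaceT.
Qed.

Let corona_closed : closed (corona i).
Proof.
apply: open_closedC; rewrite openE => _ [x _ <-].
have [K] := lcX (I : [set: X] x); rewrite withinET => Kx [cK _].
move: Kx; rewrite nbhsE => -[W [/(compactification_open ci)[V oV ->] Vx] VK].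
apply: filterS (open_nbhs_nbhs (conj oV Vx)) => y Vy.
apply: contrapT => nr.
have [|w [[Vw nKw] [z _ zE]]] :=
    @compactification_dense _ _ _ ci (V `&` ~` (i @` K)) _
      (openI oV (closed_openC (image_closed cK))).
  by exists y; split => // -[z _ zy]; apply: nr; exists z.
by apply: nKw; exists z => //; apply: VK; rewrite /= zE.
Qed.

Let preimage_compact (K : set Y) :
  compact K -> K `<=` range i -> compact (i @^-1` K).
Proof.
move=> cK Kr F PF FK.
have [//|y [Ky Fy]] := cK (i @ F) _.
have [x _ xy] := Kr _ Ky; exists x; split; first by rewrite /= xy.
move=> A B FA; rewrite nbhsE.
move=> -[_ [/(compactification_open ci)[V oV ->] Vx] VB].
have [||_ [[a Aa <-] Va]] := Fy (i @` A) V.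
- by apply: (@filterS _ F _ A) FA => a Aa; exists a.
- by apply: open_nbhs_nbhs; split => //; rewrite -xy.
- by exists a; split => //; exact: VB.
Qed.

Let induced_bornology : bornology induced_bounded.
Proof.
split.
- move=> x; rewrite /induced_bounded /=.
  suff /closure_id <- : closed [set x] by exact: compact_set1.
  have -> : [set x] = i @^-1` [set i x].
    by apply/seteqP; split=> y /= => [->//|]; exact: compactification_inj.
  apply: preimage_closed => [y _|]; first exact: i_cont.
  apply: accessible_closed_set1; apply: hausdorff_accessible.
  exact: compactification_hausdorff ci.
- move=> A C AC; rewrite /induced_bounded /= => cC.
  by apply: subclosed_compact cC (closureS AC); exact: closed_closure.
- move=> A C cA cC; rewrite /induced_bounded /= closureU.
  exact: compactU.
Qed.

Let induced_near_sym A B : induced_near A B -> induced_near B A.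
Proof. by rewrite /induced_near [closure (i @` A) `&` _]setIC. Qed.

Let bounded_closure A :
  induced_bounded A -> closure (i @` A) `<=` range i.
Proof.
move=> cA; apply: (@subset_trans _ (i @` closure A)).
  apply: closure_subset_closed; first exact: image_closed.
  by apply: image_subset; exact: subset_closure.
by move=> _ [x _ <-]; exists x.
Qed.

Let induced_near_unbounded A B :
  induced_near A B -> ~ induced_bounded A /\ ~ induced_bounded B.
Proof.
by move=> [y [[Ay By] ry]]; split => /bounded_closure; apply: contra_not ry;
  exact.
Qed.

Let induced_nearI A B : ~ induced_bounded (A `&` B) -> induced_near A B.
Proof.
move=> uAB; apply: contrapT => nAB; apply: uAB.
set K := closure (i @` (A `&` B)).
have cK : compact K.
  apply: (subclosed_compact _ (compactification_compact ci)) => //.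
  exact: closed_closure.
have Kr : K `<=` range i.
  move=> y Ky; apply: contrapT => ry; apply: nAB; exists y; split => //.
  by split; apply: closureS Ky; apply: image_subset => x [].
apply: (subclosed_compact _ (preimage_compact cK Kr)).
  exact: closed_closure.
apply: closure_subset_closed.
  by apply: preimage_closed => [x _|]; [exact: i_cont|exact: closed_closure].
by move=> x ABx; apply: subset_closure; exists x.
Qed.

Let induced_nearU A B C :
  induced_near (A `|` B) C <-> induced_near A C \/ induced_near B C.
Proof.
rewrite /induced_near image_setU closureU !setIUl; split.
  by move=> [y [yA|yB]]; [left|right]; exists y.
by move=> [[y yA]|[y yB]]; exists y; [left|right].
Qed.

Let induced_near_strong A B : ~ induced_near A B ->
  exists E, ~ induced_near A E /\ ~ induced_near (~` E) B.
Proof.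
move=> nAB.
have nY := compact_normal (compactification_hausdorff ci)
  (compactification_compact ci).
set KA := closure (i @` A) `&` corona i.
set KB := closure (i @` B) `&` corona i.
have cKA : closed KA by apply: closedI => //; exact: closed_closure.
have oKB : open (~` KB).
  by apply: closed_openC; apply: closedI => //; exact: closed_closure.
have [|W /set_nbhsP[U [oU KAU UW]] WKB] := nY _ cKA (~` KB).
  apply/set_nbhsP; exists (~` KB); split => // y [Ay ry] [By _].
  by apply: nAB; exists y.
exists (i @^-1` ~` U); split => [[y [[Ay Ey] ry]]|[y [[Ey By] ry]]].
  have : (~` U) y.
    apply: closure_subset_closed Ey; first exact: open_closedC.
    by move=> _ [x nUx <-].
  by apply; apply: KAU.
have : (~` KB) y.
  apply: WKB; apply: closureS Ey => _ [x nnUx <-]; apply: UW.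
  exact: contrapT.
by apply.
Qed.

Definition induced_coarse_proximity : coarse_proximity X :=
  CoarseProximity induced_bornology induced_near_sym induced_near_unbounded
    induced_nearI induced_nearU induced_near_strong.

End induced.

(* Main.v *)
Require Import Defs.
From HB Require Import structures.
From mathcomp Require Import all_boot all_order all_algebra finmap.
From mathcomp Require Import all_classical all_reals all_analysis.

Set Implicit Arguments.
Unset Strict Implicit.
Unset Printing Implicit Defensive.

Import Order.TTheory GRing.Theory Num.Theory.
Local Open Scope classical_set_scope.

(** Attach to each subset A of X its trace on the corona Z, the set
    cl(i(A)) `&` Z. All the data of the coarse proximity that enter asInd can
    be read off Z through this assignment: A and B are near exactly when their
    traces meet, and A is bounded exactly when its trace is empty. The role of
    metrizability is to make the assignment onto the closed sets: a closed
    F contained in the trace of A is the trace of some C `<=` A, obtained by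
    taking, for every n, a finite subset of A that approximates F up to
    1/(n+1), and collecting all these points; they can only accumulate at F
    ([metrizable_closed_realize]).

    The record [trace_model] isolates these properties, for an arbitrary
    compact T1 space T in the place of Z, and everything else follows from it.
    - The boundary of b is T: the point t corresponds to the cluster of the sets
      whose trace contains t, and the trace of A in the boundary corresponds to
      tr A ([model_point_range], [initial_model_point]). Hence asymptotic
      separators are the sets whose trace is a separator in T
      ([separator_trace]), and the boundary with its own traces is a model too
      ([boundary_trace_model]).
    - The models are hereditary: the coarse subspace C is modelled by the
      subspace tr C of T ([sub_trace_model]). An arbitrary C need not be locally
      compact, so the induction cannot be run on compactifications; it can be
      run on models.
    - In a model, pairs of disjoint closed sets of T are exactly the pairs of
      traces of sets that are not near, and the separators between them, being
      closed, are exactly the traces of the asymptotic separators. So the two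
      inductive definitions agree level by level ([asInd_lt_model]).

    Both the corona and the boundary are models of the induced coarse
    proximity, so both have large inductive dimension asInd X. *)

(** * Initial maps and subspaces *)

(** Embeddings, without injectivity: the topology of S is pulled back
    along f. It covers the compactification map, the inclusion of a subspace
    and the homeomorphism onto the boundary. *)
Definition initial_map (S T : topologicalType) (f : S -> T) :=
  forall U : set S, open U <-> exists2 V : set T, open V & U = f @^-1` V.

Section initial_map.
Context {S T : topologicalType} (f : S -> T).
Hypothesis f_init : initial_map f.

Lemma initial_map_continuous : continuous f.
Proof. by apply/continuousP => V oV; apply/f_init; exists V. Qed.

Lemma initial_map_closed (F : set S) :
  closed F <-> exists2 G : set T, closed G & F = f @^-1` G.
Proof.
rewrite -openC; split=> [/f_init[V oV FV]|[G cG ->]].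
  exists (~` V); first exact: open_closedC.
  by rewrite -preimage_setC -FV setCK.
by apply/f_init; exists (~` G); [exact: closed_openC|rewrite -preimage_setC].
Qed.

(** A filter on S is pushed to T, where it clusters at a point of the closed
    range; as every neighbourhood in S comes from T, any preimage of that point
    is a cluster point. *)
Lemma initial_map_compact :
  compact [set: T] -> closed (range f) -> compact [set: S].
Proof.
move=> cT cf F PF _.
have [y [[x _ xy] Fy]] : (range f `&` cluster (f @ F)) !=set0.
  apply: (subclosed_compact cf cT) => //.
  by apply: (@filterE _ F) => x; exists x.
exists x; split=> // A B FA; rewrite nbhsE => -[_ [/f_init[V oV ->] Vx] VB].
have [||_ [[a Aa <-] Va]] := Fy (f @` A) V.
- by apply: (@filterS _ F _ A) FA => a Aa; exists a.
- by apply: open_nbhs_nbhs; split=> //; rewrite -xy.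
- by exists a; split=> //; exact: VB.
Qed.

(** An initial surjection is bijective on open sets, so separators correspond
    in both directions. *)
Lemma separator_preimage (A B C : set T) : range f = setT ->
  separator (f @^-1` A) (f @^-1` B) (f @^-1` C) <-> separator A B C.
Proof.
move=> fT; have inj (P Q : set T) : f @^-1` P `<=` f @^-1` Q -> P `<=` Q.
  move=> PQ y Py; have [x _ xy] : range f y by rewrite fT.
  by move: Py; rewrite -xy; exact: PQ.
split=> [|[U [V [oU oV UV CUV [AU BV]]]]].
  move=> [_ [_ [/f_init[U oU ->] /f_init[V oV ->] UV CUV [AU BV]]]].
  exists U, V; split=> //.
  - by rewrite -subset0; apply: inj; rewrite preimage_setI UV preimage_set0.
  - by apply/seteqP; split; apply: inj; rewrite -preimage_setC
      preimage_setU CUV.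
  - by split; exact: inj.
exists (f @^-1` U), (f @^-1` V); split.
- by apply/f_init; exists U.
- by apply/f_init; exists V.
- by rewrite -preimage_setI UV preimage_set0.
- by rewrite -preimage_setU -CUV -preimage_setC.
- by split; exact: preimage_subset.
Qed.

End initial_map.

Lemma range_set_val (T : Type) (A : set T) : range (set_val : A -> T) = A.
Proof.
apply/seteqP; split=> [_ [x _ <-]|x Ax]; first exact: set_valP.
by exists (SigSub (mem_set Ax)).
Qed.

Lemma image_preimage_set_val (T : Type) (A B : set T) : B `<=` A ->
  set_val @` ((set_val : A -> T) @^-1` B) = B.
Proof.
move=> BA; apply/seteqP; split=> [_ [x Bx <-]//|x Bx].
by exists (SigSub (mem_set (BA _ Bx))).
Qed.

Section set_type.
Context {T : topologicalType} (A : set T).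

Lemma initial_map_set_val : initial_map (set_val : A -> T).
Proof. by move=> U; split=> [[V oV <-]|[V oV ->]]; exists V. Qed.

Lemma set_type_compact : compact [set: T] -> closed A ->
  compact [set: set_type A].
Proof.
move=> cT cA; apply: (initial_map_compact initial_map_set_val) => //.
by rewrite range_set_val.
Qed.

Lemma set_type_closed1 (x : A) : closed [set set_val x] -> closed [set x].
Proof.
move=> cx; apply/(initial_map_closed initial_map_set_val).
exists [set set_val x] => //; apply/seteqP; split=> y /= => [->//|].
by rewrite set_valE => /val_inj.
Qed.

Lemma preimage_set_val_neq0 (B : set T) :
  B `<=` A -> (set_val : A -> T) @^-1` B !=set0 <-> B !=set0.
Proof.
move=> BA; split=> [[x Bx]|[x Bx]]; first by exists (set_val x).
by exists (SigSub (mem_set (BA _ Bx))).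
Qed.

End set_type.

(** * Models of the boundary *)

(** The properties of the assignment of traces that determine both the boundary
    and the dimensions. [model_realize] is surjectivity onto the closed sets, in
    the strong form that passes to subspaces. *)
Record trace_model X (b : coarse_proximity X) (T : topologicalType)
    (tr : set X -> set T) : Prop := TraceModel {
  model_compact : compact [set: T] ;
  model_closed1 : forall t : T, closed [set t] ;
  model_closed : forall A, closed (tr A) ;
  model_setT : tr setT = setT ;
  model_setU : forall A B, tr (A `|` B) = tr A `|` tr B ;
  model_near : forall A B, cnear b A B <-> tr A `&` tr B !=set0 ;
  model_realize : forall A F, closed F -> F `<=` tr A ->
    exists2 C, C `<=` A & tr C = F }.

Section trace_model_theory.
Context {X : Type} (b : coarse_proximity X) {T : topologicalType}.
Variable tr : set X -> set T.
Hypothesis M : trace_model b tr.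
Implicit Types A B C : set X.

Lemma model_subset A B : A `<=` B -> tr A `<=` tr B.
Proof. by move=> /setUidr <-; rewrite (model_setU M); left. Qed.

Lemma model_bounded A : cbounded b A <-> tr A = set0.
Proof.
split=> [bA|A0].
  apply: contrapT => /eqP/set0P[t At].
  have /cnear_unbounded[] // : cnear b A A.
  by apply/(model_near M); exists t.
apply: contrapT => uA.
have /(model_near M)[t] : cnear b A A by apply: cnearI; rewrite setIid.
by rewrite A0 => -[].
Qed.

Lemma model_realize_closed (F : set T) : closed F -> exists C, tr C = F.
Proof.
move=> cF; have [|C _ <-] := model_realize M (A := setT) cF; last by exists C.
by rewrite (model_setT M).
Qed.

(** The empty closed set is realized inside the empty set. An argument through
    bounded sets fails: when X is empty, the empty set can be unbounded. *)
Lemma model_set0 : tr set0 = set0.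
Proof.
have [C] := model_realize M (@closed0 T) (@sub0set _ (tr set0)).
by rewrite subset0 => ->.
Qed.

Lemma model_realize1 (t : T) : exists C, tr C = [set t].
Proof. exact/model_realize_closed/(model_closed1 M). Qed.

(** The dimension inductions pass from X to an arbitrary subset C. Realization
    relative to a set A, and not only to X, is what makes the restricted
    assignment onto the closed sets of tr C again. *)
Lemma sub_trace_model C : trace_model (sub_coarse_proximity b C)
  (fun A : set C => (set_val : tr C -> T) @^-1` tr (set_val @` A)).
Proof.
have sC (A : set C) : tr (set_val @` A) `<=` tr C.
  by apply: model_subset => _ [x _ <-]; exact: set_valP.
split.
- apply: set_type_compact; first exact: (model_compact M).
  exact: (model_closed M).
- by move=> t; apply: set_type_closed1; exact: (model_closed1 M).
- move=> A; apply/(initial_map_closed (@initial_map_set_val _ _)).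
  by exists (tr (set_val @` A)) => //; exact: (model_closed M).
- by rewrite range_set_val; apply/seteqP; split=> t // _; exact: set_valP.
- by move=> A B; rewrite image_setU (model_setU M) preimage_setU.
- move=> A B; rewrite -preimage_setI preimage_set_val_neq0; last first.
    by move=> t [/sC].
  exact: model_near M _ _.
- move=> A F /(initial_map_closed (@initial_map_set_val _ _))[G cG ->] GA.
  have [||D DA DG] := model_realize M (A := set_val @` A) (F := tr C `&` G).
  + by apply: closedI => //; exact: (model_closed M).
  + by move=> t [Ct Gt]; have /= := GA (SigSub (mem_set Ct)); exact.
  exists (set_val @^-1` D).
    by move=> x /DA[y Ay]; rewrite set_valE => /val_inj <-.
  rewrite image_preimage_set_val; last first.
    by move=> _ /DA[x _ <-]; exact: set_valP.
  rewrite DG preimage_setI; apply/seteqP; split=> t; first by case.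
  by split=> //; exact: set_valP.
Qed.

(** Take P0 with trace exactly {t}. The intersection of P0 and A has empty
    trace, so removing it leaves the trace of P0 unchanged, and makes
    the set disjoint from A as the discrete extension demands. *)
Lemma model_point_apart A t : ~ tr A t ->
  exists2 P, tr P t & ~ dnear b A P.
Proof.
move=> nAt; have [P0 P0t] := model_realize1 t.
have AP A' P' : tr A' `&` tr P' = set0 -> ~ cnear b A' P'.
  by move=> AP0 /(model_near M)[u]; rewrite AP0.
have trI : tr (P0 `&` A) = set0.
  rewrite -subset0 => u PAu; apply: nAt.
  have : tr P0 u by apply: model_subset PAu => x [].
  by rewrite P0t => <-; apply: model_subset PAu => x [].
have trD : tr (P0 `\` A) = [set t].
  by rewrite -P0t -{2}(setUIDK P0 A) (model_setU M) trI set0U.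
exists (P0 `\` A); first by rewrite trD.
case=> [[x [Ax [_]]] //|]; apply: AP; rewrite trD -subset0 => u [Au ut].
by apply: nAt; rewrite -ut.
Qed.

Lemma model_cluster t : is_cluster b [set A | tr A t].
Proof.
split=> [A At|A B At Bt|C Cn|A B] /=.
- by apply/set0P/negP => /eqP A0; move: At; rewrite /= A0 model_set0.
- by right; apply/(model_near M); exists t.
- by apply: contrapT => /model_point_apart[P Pt]; apply; exact: Cn.
- by rewrite (model_setU M).
Qed.

Lemma model_cluster_boundary t : boundary b (Smirnov (model_cluster t)).
Proof. by move=> B /model_bounded Bt; rewrite /= Bt. Qed.

Definition model_point t : set_type (boundary b) :=
  SigSub (mem_set (@model_cluster_boundary t)).

Lemma traceE A (s : set_type (boundary b)) : trace b A s <-> (set_val s) A.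
Proof. by rewrite /trace closure_smirnov_points. Qed.

Lemma trace_model_point A t : trace b A (model_point t) <-> tr A t.
Proof. exact: traceE. Qed.

Lemma preimage_model_point A : model_point @^-1` trace b A = tr A.
Proof. by apply/seteqP; split=> t /trace_model_point. Qed.

(** Clusters are maximal, so inclusion between them is equality. *)
Lemma smirnov_eq (s t : smirnov b) : (forall A, s A -> t A) -> s = t.
Proof.
move=> st; have st' : smirnov_set s = smirnov_set t.
  apply/funext => A; apply/propext; split; first exact: st.
  move=> tA; apply: (cluster_max (smirnov_cluster s)) => B /st.
  exact: (cluster_near (smirnov_cluster t)).
case: s t {st} st' => [s cs] [t ct] /= st; subst t.
by congr Smirnov; exact: Prop_irrelevance.
Qed.

Lemma model_point_inj : injective model_point.
Proof.
move=> t u tu; have [P Pt] := model_realize1 t.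
have : tr P t by rewrite Pt.
by move=> /trace_model_point; rewrite tu => /trace_model_point; rewrite Pt.
Qed.

(** A cluster is not a filter, but the sets whose complements lie outside of it
    form one: closure under intersection is the splitting axiom. No member of
    this filter is bounded, so the traces of the members form a filter base
    of closed sets of T, which has a common point t by compactness. If some A of
    the cluster had a trace missing t, then some E far from A would have a
    complement far from a set with t in its trace; but E is outside of
    the cluster, so its complement is in the filter and has t in its trace. *)
Lemma boundary_common_point (s : smirnov b) : boundary b s ->
  exists t, forall A, s A -> tr A t.
Proof.
move=> bs; pose F := [set A | ~ s (~` A)].
have FI A B : F A -> F B -> F (A `&` B).
  move=> FA FB; rewrite /F /= setCI.
  by move=> /(cluster_split (smirnov_cluster s))[].
pose G : set_system T := filter_from F tr.
have FG : ProperFilter G.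
  apply: filter_from_proper => [|A FA].
    apply: filter_from_filter => [|A B FA FB].
      by exists setT; rewrite /F /= setCT; exact: smirnov0.
    exists (A `&` B); first exact: FI.
    by move=> t ABt; split; apply: model_subset ABt => x [].
  apply/set0P/negP => /eqP/model_bounded/bs nA.
  have : s (A `|` ~` A) by rewrite setUv; exact: smirnovT.
  by case/(cluster_split (smirnov_cluster s)).
have [t [_ Gt]] := model_compact M FG filterT.
have Ft A : F A -> tr A t.
  move=> FA; apply: (model_closed M) => V; apply: Gt.
  by exists A.
exists t => A sA; apply: contrapT => /model_point_apart[P Pt] nAP.
have [E [nAE nEP]] := dnear_strong nAP.
apply: nEP; right; apply/(model_near M); exists t; split=> //; apply: Ft.
rewrite /F /= setCK => sE; apply: nAE.
exact: (cluster_near (smirnov_cluster s)).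
Qed.

Lemma model_point_range : range model_point = setT.
Proof.
apply/seteqP; split=> // s _.
have [t st] := boundary_common_point (set_valP s).
by exists t => //; apply: val_inj; apply/esym/smirnov_eq.
Qed.

Lemma closed_trace A : closed (trace b A).
Proof.
apply/(initial_map_closed (@initial_map_set_val _ _)).
by exists (closure (@smirnov_points _ b A)) => //; exact: closed_closure.
Qed.

(** In one direction, a closed set of T is some tr C, the preimage of the closed
    set trace C. In the other, a closed set of clusters is by definition cut out
    by conditions of the form C \in s, and each of these pulls back to the
    closed set tr C. *)
Lemma initial_model_point : initial_map model_point.
Proof.
move=> U; split=> [oU|[V [W oW WV] ->]].
  have [C CU] := model_realize_closed (open_closedC oU).
  exists (~` trace b C); first exact/closed_openC/closed_trace.
  by rewrite -preimage_setC preimage_model_point CU setCK.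
have cW : ~` W = [set s | smirnov_near [set s] (~` W)].
  by rewrite -smirnov_closureE; exact/closure_id/open_closedC.
have -> : model_point @^-1` V =
    ~` \bigcap_(C in [set C | forall s : smirnov b, (~` W) s -> s C]) tr C.
  rewrite -WV -[LHS]setCK; congr (~` _); apply/seteqP; split=> t.
    move=> nWt C WC; have : (~` W) (set_val (model_point t)) by [].
    by rewrite cW /= => /smirnov_near1P; apply.
  move=> Ct; have : (~` W) (set_val (model_point t)); last by [].
  by rewrite cW /=; apply/smirnov_near1P => C; exact: Ct.
apply: closed_openC; apply: closed_bigI => C _; exact: (model_closed M).
Qed.

Lemma separator_trace A B C :
  asymptotic_separator b A B C <-> separator (tr A) (tr B) (tr C).
Proof.
rewrite -!preimage_model_point; apply: iff_sym; apply: separator_preimage.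
  exact: initial_model_point.
exact: model_point_range.
Qed.

(** Everything is transported along the homeomorphism [model_point], under which
    the traces in the boundary pull back to tr. *)
Lemma boundary_trace_model : trace_model b (trace b).
Proof.
have fN0 (P : set (set_type (boundary b))) :
    model_point @^-1` P !=set0 <-> P !=set0.
  split=> [[t Pt]|[s]]; first by exists (model_point t).
  have [t _ <-] : range model_point s by rewrite model_point_range.
  by exists t.
have sub (P Q : set (set_type (boundary b))) :
    model_point @^-1` P `<=` model_point @^-1` Q -> P `<=` Q.
  move=> PQ s; have [t _ <-] : range model_point s by rewrite model_point_range.
  exact: PQ.
have eq (P Q : set (set_type (boundary b))) :
    model_point @^-1` P = model_point @^-1` Q -> P = Q.
  by move=> PQ; apply/seteqP; split; apply: sub; rewrite PQ.
split.
- rewrite -model_point_range; apply: continuous_compact (model_compact M).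
  exact/continuous_subspaceT/initial_map_continuous/initial_model_point.
- move=> s; have [t _ <-] : range model_point s by rewrite model_point_range.
  have [A At] := model_realize1 t.
  suff <- : trace b A = [set model_point t] by exact: closed_trace.
  apply: eq; rewrite preimage_model_point At.
  by apply/seteqP; split=> u /= => [->//|/model_point_inj].
- exact: closed_trace.
- by apply: eq; rewrite preimage_model_point (model_setT M).
- move=> A B; apply: eq.
  by rewrite preimage_setU !preimage_model_point (model_setU M).
- move=> A B; rewrite -fN0 preimage_setI !preimage_model_point.
  exact: (model_near M).
- move=> A F cF FA.
  have [||C CA CF] := model_realize M (A := A) (F := model_point @^-1` F).
  + apply/(initial_map_closed initial_model_point).
    by exists F.
  + by rewrite -preimage_model_point; exact: preimage_subset.
  by exists C => //; apply: eq; rewrite preimage_model_point.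
Qed.

End trace_model_theory.

(** * Dimension of a model *)

(** The two definitions quantify over corresponding data: disjoint closed sets
    are traces of sets that are not near, and a separator, having open
    complement, is the trace of an asymptotic separator C. The induction
    hypothesis then applies to C with its model tr C. *)
Theorem asInd_lt_model n : forall X (b : coarse_proximity X)
  (T : topologicalType) (tr : set X -> set T),
  trace_model b tr -> asInd_lt n b <-> Ind_lt n T.
Proof.
elim: n => [|n IHn] X b T tr M /=.
  by rewrite (model_bounded M) (model_setT M).
have IH C := IHn _ _ _ _ (sub_trace_model M C).
split=> [bn F G cF cG FG|Tn A B nAB].
  have [A AF] := model_realize_closed M cF.
  have [B BG] := model_realize_closed M cG.
  have [|C /(separator_trace M) ABC Cn] := bn A B.
    by move=> /(model_near M)[t]; rewrite AF BG FG.
  by exists (tr C); [rewrite -AF -BG|exact/IH].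
have ctr := @model_closed _ _ _ _ M.
have [|F ABF Fn] := Tn _ _ (ctr A) (ctr B).
  by apply: contrapT => /eqP/set0P AB0; apply/nAB/(model_near M).
have cF : closed F.
  have [U [V [oU oV _ FUV _]]] := ABF.
  by rewrite -openC FUV; exact: openU.
have [C CF] := model_realize_closed M cF.
by exists C; [apply/(separator_trace M); rewrite CF|apply/IH; rewrite CF].
Qed.

Lemma asInd_model X (b : coarse_proximity X)
  (T : topologicalType) (tr : set X -> set T) :
  trace_model b tr -> asInd b = Ind T.
Proof.
move=> M; rewrite /asInd /Ind; congr dim_of.
by apply/funext => n; apply/propext; exact: (asInd_lt_model n M).
Qed.

(** * The corona of a metrizable compactification *)

(** Q is the union over n of finite subsets D n of P such that each point of F
    is at distance less than 1/(n+1) from D n, and conversely. Near a point away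
    from F only finitely many of the D n have points, and a finite union of
    finite sets is closed; so Q accumulates only at F. *)
Lemma metrizable_closed_realize (R : realType) (Y : topologicalType)
    (F P : set Y) : metrizable R Y -> accessible_space Y ->
    compact F -> closed F -> F `<=` closure P ->
  exists Q, [/\ Q `<=` P, closure Q `<=` F `|` Q & F `<=` closure Q].
Proof.
move=> [d [d0 dC dD dN]] T1 cF clF FP.
have dxx x : d x x = 0%R by exact/d0.
pose ball x e : set Y := [set y | (d x y < e)%R].
have ball_open x e : open (ball x e).
  rewrite openE => y xy; apply/dN; exists (e - d x y)%R.
    by rewrite subr_gt0.
  move=> z /= yz; apply: le_lt_trans (dD x y z) _.
  by rewrite addrC -ltrBrDr.
have inv_gt0 n : (0 < n.+1%:R^-1 :> R)%R by rewrite invr_gt0.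
have net n : exists D : set Y, [/\ finite_set D, D `<=` P,
    forall a, D a -> exists2 f, F f & (d f a < n.+1%:R^-1)%R &
    forall f, F f -> exists2 a, D a & (d f a < n.+1%:R^-1)%R].
  have [->|/set0P[y0 _]] := eqVneq F set0.
    by exists set0; split=> [|a []|a []|f []].
  (* The covering form of compactness is stated for pointed spaces. *)
  pose Yp : ptopologicalType :=
    HB.pack (Topological.sort Y) (isPointed.Build (Topological.sort Y) y0).
  have coverF : @cover_compact Y F.
    by move: cF; rewrite (compact_cover Yp : @compact Y = @cover_compact Y).
  have [||D' D'P FD'] := coverF Y
    [set a | P a /\ exists2 f, F f & (d f a < n.+1%:R^-1)%R]
    (fun a => ball a n.+1%:R^-1)%R.
  - by move=> a _; exact: ball_open.
  - move=> f Ff; have /FP := Ff; move=> /(_ (ball f n.+1%:R^-1)%R)[|a [Pa fa]].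
      by apply: open_nbhs_nbhs; split=> //; rewrite /ball /= dxx.
    by exists a; [split=> //; exists f|rewrite /ball /= dC].
  exists [set` D']; split.
  - exact: finite_fset.
  - by move=> a /D'P; rewrite inE => -[].
  - by move=> a /D'P; rewrite inE => -[].
  - by move=> f /FD'[a Da af]; exists a => //; rewrite dC.
have [D Dn] := choice net.
exists (\bigcup_n D n); split.
- by move=> a [n _ Da]; have [_ + _ _] := Dn n; apply.
- move=> z clz; apply: contrapT => /not_orP[nFz nQz].
  have /dN[e e0 eF] : nbhs z (~` F).
    by apply: open_nbhs_nbhs; split=> //; exact: closed_openC.
  have [N /= Ne] : exists N, forall n, (N <= n)%N -> (n.+1%:R^-1 < e / 2)%R.
    have e20 : (0 < e / 2)%R by rewrite divr_gt0.
    have [N _ NP] := near_infty_natSinv_lt (PosNum e20).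
    by exists N => n Nn; exact: NP.
  have fE : closed (\bigcup_(n in `I_N) D n).
    move/accessible_finite_set_closed : T1; apply.
    by apply: bigcup_finite => // n _; have [] := Dn n.
  have : nbhs z (ball z (e / 2)%R `&` ~` (\bigcup_(n in `I_N) D n)).
    apply: open_nbhs_nbhs; split; first exact/openI/closed_openC.
    split; first by rewrite /ball /= dxx divr_gt0.
    by move=> [n _ Dz]; apply: nQz; exists n.
  move=> /clz[a [[n _ Da] [za nDa]]].
  have [nN|Nn] := ltnP n N; first by apply: nDa; exists n.
  have [_ _ + _] := Dn n; move=> /(_ a Da)[f Ff fa].
  suff /(eF f) : (d z f < e)%R by [].
  apply: le_lt_trans (dD z a f) _; rewrite (splitr e) ltrD // dC.
  by apply: lt_trans fa _; exact: Ne.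
- move=> f Ff B /dN[e e0 eB].
  have [N _ NP] := near_infty_natSinv_lt (PosNum e0).
  have [_ _ _ /(_ f Ff)[a Da fa]] := Dn N.
  exists a; split; first by exists N.
  by apply: eB; exact: lt_trans fa (NP N (leqnn N)).
Qed.

Section corona_model.
Context {X Y : topologicalType} (i : X -> Y).
Hypotheses (lcX : locally_compact [set: X]) (ci : compactification i).

Lemma compactification_initial : initial_map i.
Proof. exact: compactification_open ci. Qed.

(** By local compactness a point of X has a compact neighbourhood K in X. An
    open set V of the compactification that cuts out a part of K in X is
    contained in i(K), because V minus i(K) is open and misses the dense image
    of X. *)
Lemma closed_corona : closed (corona i).
Proof.
apply: open_closedC; rewrite openE => _ [x _ <-].
have [K] := lcX (I : [set: X] x); rewrite withinET => Kx [cK _].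
move: Kx; rewrite nbhsE => -[_ [/compactification_initial[V oV ->] Vx] VK].
have ciK : closed (i @` K).
  apply: compact_closed (compactification_hausdorff ci) _.
  apply: continuous_compact cK.
  exact/continuous_subspaceT/initial_map_continuous/compactification_initial.
apply: (@filterS _ _ _ V); last exact: open_nbhs_nbhs.
move=> y Vy; apply: contrapT => nry.
have [||z [[Vz nKz] [w _ wz]]] :=
    @compactification_dense _ _ _ ci (V `&` ~` (i @` K)).
- by exists y; split=> // -[w _ wy]; apply: nry; exists w.
- by apply: openI => //; exact: closed_openC.
- by apply: nKz; exists w => //; apply: VK; rewrite /= wz.
Qed.

Variable R : realType.
Hypothesis mY : metrizable R Y.

Let b := induced_coarse_proximity lcX ci.

(** For [model_realize], the finite approximations taken inside i(A) give a set
    Q whose closure adds to Q exactly the points of F; the points of Q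
    themselves are outside of the corona. *)
Lemma corona_trace_model :
  trace_model b (fun A => (set_val : corona i -> Y) @^-1` closure (i @` A)).
Proof.
have cY := compactification_compact ci.
have T1 := hausdorff_accessible (compactification_hausdorff ci).
have nearE A B : cnear b A B <->
  closure (i @` A) `&` closure (i @` B) `&` corona i !=set0 by [].
split.
- exact: set_type_compact cY closed_corona.
- by move=> t; apply: set_type_closed1; exact: accessible_closed_set1.
- move=> A; apply/(initial_map_closed (@initial_map_set_val _ _)).
  by exists (closure (i @` A)) => //; exact: closed_closure.
- have dense_closure : closure (range i) = setT.
    apply/seteqP; split=> // y _ B; rewrite nbhsE => -[V [oV Vy] VB].
    have [||z [Vz iz]] := @compactification_dense _ _ _ ci V => //.
      by exists y.
    by exists z; split=> //; exact: VB.
  by rewrite dense_closure preimage_setT.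
- by move=> A B; rewrite image_setU closureU preimage_setU.
- move=> A B; rewrite nearE; split=> [[y [[Ay By] ry]]|[t [At Bt]]].
    by exists (SigSub (mem_set ry)).
  by exists (set_val t); split; [|exact: set_valP].
- move=> A F /(initial_map_closed (@initial_map_set_val _ _))[G cG ->] GA.
  have cF : closed (corona i `&` G) by exact: closedI closed_corona cG.
  have [||Q [QA QF FQ]] := @metrizable_closed_realize _ _ _ (i @` A) mY T1 _ cF.
  + exact: subclosed_compact cF cY _.
  + by move=> y [ry Gy]; have /= := GA (SigSub (mem_set ry)); exact.
  exists (A `&` i @^-1` Q); first by move=> x [].
  have -> : i @` (A `&` i @^-1` Q) = Q.
    apply/seteqP; split=> [_ [x [_ Qx] <-]//|y Qy].
    by have [x Ax xy] := QA _ Qy; exists x => //; split=> //; rewrite /= xy.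
  apply/seteqP; split=> t /= Qt; last by apply: FQ; split=> //; exact: set_valP.
  have [[]//|/QA[x _ xt]] := QF _ Qt.
  by have [] := set_valP t; exists x.
Qed.

End corona_model.

Theorem corollary4p8 (R : realType) (X Xbar : topologicalType)
  (lcX : locally_compact [set: X]) (hX : hausdorff_space X)
  (i : X -> Xbar) (ci : compactification i) (mXbar : metrizable R Xbar) :
  asInd (induced_coarse_proximity lcX ci)
    = Ind (set_type (boundary (induced_coarse_proximity lcX ci)))
  /\ Ind (set_type (boundary (induced_coarse_proximity lcX ci)))
    = Ind (set_type (corona i)).
Proof.
have M := corona_trace_model lcX ci mXbar.
have bM := boundary_trace_model M.
by rewrite -(asInd_model M) -(asInd_model bM).
Qed.
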